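(* For each integer $a\geq 2$, the function $h\mapsto Q_a(h)$ on nonnegative integers extends uniquely to a polynomial with rational coefficients, of degree $d_a$ (also denoted $Q_a$). There is a unique nonzero even polynomial $q_a(c)\in\mathbb{Q}[c]$ such that, as an identity of polynomials in $c$, $$Q_a(c-a/2)=c\binom{c+a/2-1}{a-1}\,q_a(c).$$ Writing $\ell_a=d_a-a$, we have $$\deg q_a=\ell_a,\qquad \operatorname{den}(q_a)\ \Bigm|\ \begin{cases} d_a!/(a-1)!, & a\text{ even},\\ 2^{\ell_a}\,d_a!/(a-1)!, & a\text{ odd}.\end{cases}$$
   Context: Write $[a]=\{1,\ldots,a\}$. A plane partition in an $(a,a,H)$-box is an integer matrix $\pi=(\pi_{ij})_{(i,j)\in[a]^2}$ with $0\leq\pi_{ij}\leq H$ for all $i,j$, $\pi_{ij}\geq\pi_{i+1,j}$ for $1\leq i<a$, $1\leq j\leq a$, and $\pi_{ij}\geq\pi_{i,j+1}$ for $1\leq i\leq a$, $1\leq j<a$. Let $\tau(i,j)=(a+1-j,a+1-i)$ on $[a]^2$. For an integer $h\geq0$, $\mathcal{Q}_a(h)$ is the set of plane partitions in an $(a,a,2h)$-box such that $\pi_{ij}+\pi_{\tau(i,j)}=2h$ whenever $i\neq j$ (no condition on main-diagonal entries), and $Q_a(h)=|\mathcal{Q}_a(h)|$. Put $d_a=\lceil a^2/2\rceil$. For $f\in\mathbb{Q}[c]$, $\operatorname{den}(f)$ is the least positive integer $D$ such that $Df$ has integer coefficients. Binomials are polynomials: $\binom{x}{k}=\frac{x(x-1)\cdots(x-k+1)}{k!}$,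 $\binom{x}{0}=1$. A polynomial $p$ is even if $p(-c)=p(c)$. *)

(* Defs.v *)
From HB Require Import structures.
From mathcomp Require Import all_boot all_order all_algebra.

Set Implicit Arguments.
Unset Strict Implicit.
Unset Printing Implicit Defensive.

Import Order.TTheory GRing.Theory Num.Theory.
Local Open Scope ring_scope.

(* Indices run over 'I_a = {0, ..., a-1} instead of [a] = {1, ..., a}. *)
Definition plane_partition (a H : nat) (p : 'M['I_H.+1]_a) : bool :=
  [forall i : 'I_a, forall i' : 'I_a, forall j : 'I_a,
     (i' == i.+1 :> nat) ==> (p i' j <= p i j)%N] &&
  [forall i : 'I_a, forall j : 'I_a, forall j' : 'I_a,
     (j' == j.+1 :> nat) ==> (p i j' <= p i j)%N].

(* rev_ord i = a - 1 - i is the 0-based form of i |-> a + 1 - i. *)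
Definition tau (a : nat) (x : 'I_a * 'I_a) : 'I_a * 'I_a :=
  (rev_ord x.2, rev_ord x.1).

Definition Qset (a h : nat) : {set 'M['I_(2 * h).+1]_a} :=
  [set p : 'M['I_(2 * h).+1]_a | plane_partition p &&
    [forall i : 'I_a, forall j : 'I_a, (i != j) ==>
       (p i j + p (tau (i, j)).1 (tau (i, j)).2 == 2 * h)%N]].

Definition Qcount (a h : nat) : nat := #|Qset a h|.

Definition extends_Qcount (a : nat) (P : {poly rat}) : Prop :=
  forall h : nat, P.[h%:R] = (Qcount a h)%:R.

Definition dexp (a : nat) : nat := uphalf (a ^ 2).

(* For a >= 2 the truncated subtraction is exact, as a <= dexp a; for the same
   reason (dexp a)`! %/ (a - 1)`! is an exact quotient. *)
Definition ell (a : nat) : nat := (dexp a - a)%N.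

Definition binom_poly (x : {poly rat}) (k : nat) : {poly rat} :=
  (k`!%:R)^-1 *: \prod_(i < k) (x - i%:R).

Definition even_polynomial (p : {poly rat}) : Prop := p \Po (- 'X) = p.

Definition clears_den (f : {poly rat}) (D : nat) : bool :=
  (0 < D)%N && (D%:R *: f \is a polyOver Num.int).

Lemma clears_den_ex (f : {poly rat}) : exists D : nat, clears_den f D.
Proof.
exists (\prod_(i < size f) `|denq f`_i|)%N; apply/andP; split.
  by apply: prodn_gt0 => i; rewrite absz_gt0 denq_neq0.
apply/polyOverP => i; rewrite coefZ.
have [lt_i | le_i] := ltnP i (size f); last by rewrite nth_default // mulr0 rpred0.
rewrite (bigD1 (Ordinal lt_i)) //= natrM mulrAC rpredM ?rpred_nat //.
rewrite natr_absz normr_denq -{2}(divq_num_den f`_i) mulrC divfK ?rpred_int //.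
by rewrite intr_eq0 denq_neq0.
Qed.

Definition den (f : {poly rat}) : nat := ex_minn (clears_den_ex f).

(* Composition substitutes c - a/2 (with 'X for c) into Qa, which stands for the
   polynomial extending Qcount a. *)
Definition Q_factorization (a : nat) (Qa q : {poly rat}) : Prop :=
  Qa \Po ('X - (a%:R / 2%:R)%:P) =
    'X * binom_poly ('X + (a%:R / 2%:R)%:P - 1) (a - 1) * q.

(* Main.v *)
Require Import Defs.
From mathcomp Require Import all_boot all_order all_algebra.
From mathcomp Require Import zify ring lra.
Set Implicit Arguments.
Unset Strict Implicit.
Unset Printing Implicit Defensive.

(** Put n = a - 1, so that indices run over 0, ..., n and tau reflects across
the antidiagonal i + j = n.  In an element p of Q_a(h), complementarity forces
p >= h above the antidiagonal, p <= h below it and p = h on it, the centre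
excepted (it exists for a odd only).  So p is determined by the deviations
|p - h| on the cells above the antidiagonal, together with the diagonal cells on
or below it: d_a cells in all.  Reading a lower diagonal cell as a second copy of
its mirror image, the inequalities between neighbours of p become order
relations between deviations.  The sign of the centre is lost; when p < h there,
the deviation is lowered by one, which turns the weak inequalities between the
centre and its neighbours into strict ones.  This is [Qcount_npart]: Q_a(h) is
the number of order-preserving maps from a poset with d_a elements to
{0, ..., h}, plus, for a odd, the number of such maps that are strict at the
centre.

Both terms are instances of Stanley's (P, omega)-partitions, where a total order e
on the poset decides which relations are strict.  Sorting the poset by the
value of f, ties broken by e, splits the partitions according to linear
extensions, and those sorted by a given linear extension with k ascents are
counted by binomial(m + k, d) ([npart_sum_linext]).  Hence the count is a
polynomial of degree d in m, integral after multiplication by d!, and since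
binomial(-m + k, d) = (-1)^d binomial(m + d - 1 - k, d), where d - 1 - k is the
number of ascents for the reversed order, its value at -m is up to sign the
count for the converse of e, which exchanges weak and strict relations
([npart_polynomial]).

Away from the centre, the poset is graded with n levels.  Subtracting the rank
therefore turns a strict map into a weak one with a range shorter by n - 1,
while the centre keeps its value and merely exchanges its two regimes
([npart_converse]).  As the two regimes are summed, this gives
Q_a(-a - h) = (-1)^d Q_a(h), and Q_a(-k) = 0 for 0 < k < a because a strict map
needs n values ([Qcount_polynomial]).

In the centred variable c = h + a/2 the roots -1, ..., -(a-1) yield the product
of the binomial coefficient, and reciprocity makes the cofactor odd, so that a
further factor c splits off and leaves an even quotient.  The roots are integers,
so d! Q_a factors through an integer polynomial v, and the denominator of q_a
comes only from the shift by a/2 in v.  When a is odd, this shift costs a priori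
one power of 2 for each degree of v, that is 2^(l+1) with l = deg q_a; dividing
by c drops the constant coefficient, the only one that needs the last factor
2 ([half_shift_coef_int]). *)

(** * Partitions of a poset and its linear extensions *)

Lemma card_mutual_inverse (X Y : finType) (A : {set X}) (B : {set Y})
    (f : X -> Y) (g : Y -> X) :
  {in A, forall x, (f x \in B) /\ g (f x) = x} ->
  {in B, forall y, (g y \in A) /\ f (g y) = y} -> #|A| = #|B|.
Proof.
move=> fP gP; have -> : B = f @: A.
  apply/setP=> y; apply/idP/imsetP => [By | [x Ax ->]]; last by have [] := fP x Ax.
  by have [Agy fgy] := gP y By; exists (g y).
rewrite card_in_imset // => x x' Ax Ax' eq_f.
by have [_ <-] := fP x Ax; rewrite eq_f; have [_ ->] := fP x' Ax'.
Qed.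

Definition total_order (T : Type) (e : rel T) :=
  [/\ total e, transitive e & antisymmetric e].

Definition converse (T : Type) (e : rel T) : rel T := fun x y => e y x.

Lemma total_order_converse (T : Type) (e : rel T) :
  total_order e -> total_order (converse e).
Proof.
case=> tot tr asym; split=> [x y | y x z exy eyz | x y].
- exact: tot.
- exact: tr eyz exy.
- by rewrite /converse andbC; apply: asym.
Qed.

(** Lexicographic comparison of the pairs (f x, x), the second components being
ordered by e: the value of e x y as 0 or 1 says whether equality of the first
components is allowed. This arithmetic form makes the relation a strict
inequality between shifted values, as the counting of chains requires. *)
Definition lexle (T : Type) (e : rel T) (f : T -> nat) : rel T :=
  fun x y => f x < f y + e x y.

Lemma lexle_total_order (T : Type) (e : rel T) (f : T -> nat) :
  total_order e -> total_order (lexle e f).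
Proof.
case=> tot tr asym; split=> [x y | y x z | x y]; rewrite /lexle.
- by have := tot x y; case: (e x y); case: (e y x); lia.
- by have := tr y x z; case: (e x y); case: (e y z); case: (e x z); lia.
- move=> /andP[lexy leyx]; apply: asym; apply/andP.
  by move: lexy leyx; case: (e x y); case: (e y x); lia.
Qed.

(** Stanley's (P, omega)-partitions, with e in place of the labelling omega: f is
weakly increasing along r, and strictly so along the relations that e reverses. *)
Definition ppartition (T : finType) (r e : rel T) (f : T -> nat) : bool :=
  [forall u, forall v, r u v ==> lexle e f u v].

Definition npart (T : finType) (r e : rel T) (m : nat) : nat :=
  #|[set f : {ffun T -> 'I_m} | ppartition r e (fun x => f x)]|.

Definition linext (T : finType) (r : rel T) (t : seq T) : bool :=
  [forall u, forall v, r u v ==> (index u t <= index v t)].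

(** Whether f is a partition depends only on the order in which f, ties broken by
e, sorts the elements: a relation of r holds for the lexicographic order exactly
when it agrees with the positions in the sorted sequence. *)
Lemma linext_sorted (T : finType) (r e : rel T) (f : T -> nat) (t : seq T) :
  total_order e -> perm_eq t (enum T) -> sorted (lexle e f) t ->
  linext r t = ppartition r e f.
Proof.
move=> /(lexle_total_order f) [tot tr asym] te st.
have refl : reflexive (lexle e f) by move=> x; have := tot x x; rewrite orbb.
have tT x : x \in t by rewrite (perm_mem te) mem_enum.
apply: eq_forallb => u; apply: eq_forallb => v; congr (_ ==> _).
have leP x y : index x t <= index y t -> lexle e f x y.
  exact: (sorted_leq_index tr refl st).
apply/idP/idP => [/leP // | uv]; case: leqP => // lt_vu.
have /leP vu := ltnW lt_vu; move: (asym u v); rewrite uv vu => /(_ isT) eq_uv.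
by rewrite eq_uv ltnn in lt_vu.
Qed.

Definition ascents (T : Type) (e : rel T) (x0 : T) (t : seq T) (i : nat) : nat :=
  \sum_(j < i) e (nth x0 t j) (nth x0 t j.+1).

Lemma ascentsS (T : Type) (e : rel T) (x0 : T) (t : seq T) (i : nat) :
  ascents e x0 t i.+1 = ascents e x0 t i + e (nth x0 t i) (nth x0 t i.+1).
Proof. by rewrite /ascents big_ord_recr. Qed.

(** Consecutive elements of a sequence without repetitions are an ascent for
exactly one of e and its converse. This is what makes the binomial coefficients
attached to e and to its converse reciprocal. *)
Lemma ascents_converse (T : eqType) (e : rel T) (x0 : T) (t : seq T) (i : nat) :
  total_order e -> uniq t -> i < size t ->
  ascents e x0 t i + ascents (converse e) x0 t i = i.
Proof.
case=> tot _ asym ut; elim: i => [|i IHi] lt_i; first by rewrite /ascents !big_ord0.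
rewrite !ascentsS addnACA IHi 1?ltnW // /converse.
have := tot (nth x0 t i) (nth x0 t i.+1); have := asym (nth x0 t i) (nth x0 t i.+1).
case: (e _ _); case: (e _ _) => //= eq_x _; try lia.
by have /eqP := eq_x isT; rewrite nth_uniq // 1?ltnW // => /eqP; lia.
Qed.

Lemma leq_gap (v : nat -> nat) (n i j : nat) :
  (forall k, k.+1 < n -> v k < v k.+1) -> i <= j < n -> v i + (j - i) <= v j.
Proof.
move=> v_lt /andP[le_ij]; elim: j le_ij => [|j IHj] le_ij lt_jn.
  by (have -> : i = 0 by lia); lia.
have [-> | ne_ij] := eqVneq i j.+1; first lia.
by have := v_lt j lt_jn; have := IHj ltac:(lia) ltac:(lia); lia.
Qed.

Lemma leq_ascents (T : Type) (e : rel T) (x0 : T) (t : seq T) (i j : nat) :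
  i <= j -> ascents e x0 t i <= ascents e x0 t j <= ascents e x0 t i + (j - i).
Proof.
elim: j => [|j IHj] le_ij; first by (have -> : i = 0 by lia); lia.
have [-> | ne_ij] := eqVneq i j.+1; first lia.
by have := IHj ltac:(lia); rewrite ascentsS; case: (e _ _); lia.
Qed.

(** Adding to the value at position i the number of ascents before i turns the
sequence of values of f along t into a strictly increasing one. Every strictly
increasing sequence with values below m plus the total number of ascents arises
in this way, because it grows at least as fast as the number of ascents. *)
Lemma card_sorted_lexle (T : finType) (e : rel T) (x0 : T) (t : seq T) (m : nat) :
  perm_eq t (enum T) ->
  #|[set f : {ffun T -> 'I_m} | sorted (lexle e (fun x => f x)) t]|
    = 'C(m + ascents e x0 t #|T|.-1, #|T|).
Proof.
move=> te; have st : size t = #|T| by rewrite (perm_size te) -cardE.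
have ut : uniq t by rewrite (perm_uniq te) enum_uniq.
have tT x : x \in t by rewrite (perm_mem te) mem_enum.
have n_gt0 : 0 < #|T| by apply/card_gt0P; exists x0.
have [c cE] : {c | forall i, ascents e x0 t i = c i} by exists (ascents e x0 t).
have cS i : c i.+1 = c i + e (nth x0 t i) (nth x0 t i.+1) by rewrite -!cE ascentsS.
rewrite cE.
have c_le i : c i <= i.
  have c0 : c 0 = 0 by rewrite -cE /ascents big_ord0.
  by have := leq_ascents e x0 t (leq0n i); rewrite !cE c0; lia.
have cP i : i < #|T| -> c i <= c #|T|.-1 <= c i + (#|T|.-1 - i).
  by move=> lt_i; rewrite -!cE; apply: leq_ascents; lia.
(* The maps below use ordinals of successor type, hence the separate case m = 0. *)
case: m => [|m].
  rewrite bin_small; last by have := c_le #|T|.-1; lia.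
  by apply: eq_card0 => f; case: (f x0).
rewrite -card_ltn_sorted_tuples addSn.
pose enc (f : {ffun T -> 'I_m.+1}) :=
  [tuple inord (f (nth x0 t i) + c i) : 'I_(m + c #|T|.-1).+1 | i < #|T|].
pose dec (v : #|T|.-tuple 'I_(m + c #|T|.-1).+1) : {ffun T -> 'I_m.+1} :=
  [ffun x => inord (nth ord0 v (index x t) - c (index x t))].
have encE f i : i < #|T| -> nth ord0 (enc f) i = f (nth x0 t i) + c i :> nat.
  move=> lt_i; rewrite -[i]/(nat_of_ord (Ordinal lt_i)) -tnth_nth tnth_mktuple inordK //=.
  by rewrite ltnS leq_add -1?ltnS //; have /andP[] := cP i lt_i.
have sortedE (v : #|T|.-tuple 'I_(m + c #|T|.-1).+1) :
    reflect (forall i, i.+1 < #|T| -> nth ord0 v i < nth ord0 v i.+1)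
            (sorted ltn (map val v)).
  apply: (iffP (sortedP 0)); rewrite size_map size_tuple => lt_v i lt_i;
  by have := lt_v i lt_i; rewrite !(nth_map ord0) // size_tuple; lia.
have decE (v : #|T|.-tuple 'I_(m + c #|T|.-1).+1) i : sorted ltn (map val v) ->
    i < #|T| -> dec v (nth x0 t i) + c i = nth ord0 v i :> nat.
  move=> /sortedE v_lt lt_i; rewrite ffunE index_uniq ?st //.
  have := @leq_gap (fun i => nth ord0 v i) #|T| 0 i v_lt ltac:(lia).
  have := @leq_gap (fun i => nth ord0 v i) #|T| i #|T|.-1 v_lt ltac:(lia).
  have := ltn_ord (nth ord0 v #|T|.-1); have := c_le i; have := cP i lt_i.
  by move=> *; rewrite inordK; lia.
apply: (card_mutual_inverse (f := enc) (g := dec)) => [f | v]; rewrite !inE.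
  move=> /(sortedP x0) f_lt; have sf : sorted ltn (map val (enc f)).
    apply/sortedE => i lt_i; rewrite !encE ?(ltnW lt_i) //.
    by have := f_lt i; rewrite st /lexle cS => /(_ lt_i); case: (e _ _); lia.
  split=> //; apply/ffunP => x; apply/val_inj => /=.
  have lt_x : index x t < #|T| by rewrite -st index_mem.
  by have := decE _ _ sf lt_x; rewrite encE // nth_index //; lia.
move=> sv; split.
  apply/(sortedP x0) => i; rewrite st => lt_i.
  have /sortedE/(_ i lt_i) := sv; rewrite -!decE ?(ltnW lt_i) //.
  by rewrite /lexle cS; case: (e _ _); lia.
apply: eq_from_tnth => i; rewrite !(tnth_nth ord0); apply/val_inj => /=.
by rewrite encE // decE.
Qed.

(** Every f is sorted by exactly one enumeration of T, and by [linext_sorted] f is a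
partition exactly when this enumeration is a linear extension. *)
Lemma npart_sum_linext (T : finType) (r e : rel T) (x0 : T) (m : nat) :
  total_order e ->
  npart r e m = \sum_(t : #|T|.-tuple T | perm_eq t (enum T) && linext r t)
                  'C(m + ascents e x0 t #|T|.-1, #|T|).
Proof.
move=> ordE; rewrite /npart -sum1_card.
pose srt (f : {ffun T -> 'I_m}) := [tuple of sort (lexle e (fun x => f x)) (enum_tuple T)].
have sortP (f : {ffun T -> 'I_m}) :
    sorted (lexle e (fun x => f x)) (srt f) && perm_eq (srt f) (enum T).
  have [tot _ _] := lexle_total_order (fun x => f x) ordE.
  by rewrite /= sort_sorted // perm_sort perm_refl.
rewrite (partition_big srt (fun t => perm_eq t (enum T) && linext r t)) /= => [|f]; last first.
  rewrite inE => pf; have /andP[st te] := sortP f.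
  by rewrite te (linext_sorted r ordE te st).
apply: eq_bigr => t /andP[te lt]; rewrite -(card_sorted_lexle e x0 m te) -[RHS]sum1_card.
apply: eq_bigl => f; rewrite !inE; have /andP[sf pf] := sortP f.
apply/andP/idP => [[_ /eqP <-] // | st]; split.
  by rewrite -(linext_sorted r ordE te st).
have [_ tr asym] := lexle_total_order (fun x => f x) ordE.
apply/eqP/val_inj/(sorted_eq tr asym sf st).
by rewrite (permPr te).
Qed.

(** * The poset of deviations *)

(** The cells above the antidiagonal represent the off-diagonal orbits of tau that
avoid the antidiagonal. Diagonal entries are not tied to each other by
complementarity, so all of them are kept. *)
Definition is_cell (n : nat) (x : 'I_n.+1 * 'I_n.+1) : bool :=
  (x.1 + x.2 < n) || (x.1 == x.2).

Definition cell (n : nat) : finType := {x : 'I_n.+1 * 'I_n.+1 | is_cell x}.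

Definition crow (n : nat) (u : cell n) : nat := (val u).1.
Definition ccol (n : nat) (u : cell n) : nat := (val u).2.

(** Coordinates of the image in the upper half, the lower half being folded onto it
by tau. *)
Definition frow (n i j : nat) : nat := if i + j <= n then i else n - j.
Definition fcol (n i j : nat) : nat := if i + j <= n then j else n - i.

Definition adjacent (i j i' j' : nat) : bool :=
  ((i == i'.+1) && (j == j')) || ((i == i') && (j == j'.+1)).

(** The order on deviations: deviations decrease away from the top left corner once
the lower half is folded up. *)
Definition covers (n : nat) : rel (cell n) := fun u v =>
  adjacent (frow n (crow u) (ccol u)) (fcol n (crow u) (ccol u))
           (frow n (crow v) (ccol v)) (fcol n (crow v) (ccol v)).

Definition depth (n : nat) (u : cell n) : nat :=
  frow n (crow u) (ccol u) + fcol n (crow u) (ccol u).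

Definition centre (n : nat) (u : cell n) : bool := crow u + ccol u == n.

Lemma cellP (n : nat) (u : cell n) :
  [/\ crow u <= n, ccol u <= n & (crow u + ccol u < n) || (crow u == ccol u)].
Proof.
rewrite /crow /ccol; split; [by rewrite -ltnS | by rewrite -ltnS |].
by have /orP[-> // | /eqP ->] := valP u; rewrite eqxx orbT.
Qed.

Lemma cell_at (n i j : nat) : i <= n -> j <= n -> (i + j < n) || (i == j) ->
  {u : cell n | crow u = i & ccol u = j}.
Proof.
move=> le_in le_jn cij.
have c : is_cell (inord i : 'I_n.+1, inord j : 'I_n.+1).
  by rewrite /is_cell /= -val_eqE /= !inordK.
by exists (Sub _ c); rewrite /crow /ccol /= inordK.
Qed.

Lemma cell_inj (n : nat) (u v : cell n) : crow u = crow v -> ccol u = ccol v -> u = v.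
Proof.
rewrite /crow /ccol => /val_inj eqr /val_inj eqc; apply: val_inj.
by rewrite [LHS]surjective_pairing [RHS]surjective_pairing eqr eqc.
Qed.

Lemma depth_cover (n : nat) (u v : cell n) : covers u v -> depth u = (depth v).+1.
Proof.
by rewrite /covers /adjacent /depth => /orP[] /andP[/eqP -> /eqP ->]; rewrite ?addSn ?addnS.
Qed.

Lemma depth_le (n : nat) (u : cell n) : depth u <= n.
Proof. by have [? ? ?] := cellP u; rewrite /depth /frow /fcol; case: ifP; lia. Qed.

Lemma centreE (n : nat) (u : cell n) : centre u = (depth u == n).
Proof.
by have [? ? ?] := cellP u; rewrite /centre /depth /frow /fcol; case: ifP; lia.
Qed.

(** Relations go from greater to smaller depth, so labelling by n - depth makes them
all weak; a label above all others makes those leaving the centre strict. *)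
Definition label (n : nat) (b : bool) (u : cell n) : nat :=
  if b && centre u then n.*2.+1 else n - depth u.

Definition tiebreak (n : nat) (b : bool) : rel (cell n) :=
  lexle (fun u v => enum_rank u <= enum_rank v) (label b).

Lemma tiebreak_total_order (n : nat) (b : bool) : total_order (@tiebreak n b).
Proof.
apply: lexle_total_order; split=> [u v | v u w | u v].
- exact: leq_total.
- exact: leq_trans.
- by rewrite -eqn_leq => /eqP/val_inj/enum_rank_inj.
Qed.

Lemma tiebreak_cover (n : nat) (b : bool) (u v : cell n) : covers u v ->
  tiebreak b u v = ~~ (b && centre u) /\ tiebreak b v u = (b && centre u).
Proof.
move=> /depth_cover duv; have le_u := depth_le u; rewrite /tiebreak /lexle /label !centreE.
have -> : (depth v == n) = false by have := depth_le u; lia.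
by rewrite andbF; case: b => /=; case: (depth u == n);
  case: (enum_rank u <= _); case: (enum_rank v <= _) => /=; lia.
Qed.

Lemma ppartition_cover (n : nat) (b : bool) (f : cell n -> nat) :
  reflect (forall u v, covers u v -> f u + (b && centre u) <= f v)
          (ppartition (@covers n) (tiebreak b) f).
Proof.
apply: (iffP forallP) => fP u.
  move=> v uv; have /forallP/(_ v) := fP u; rewrite uv /lexle.
  by have [-> _] := tiebreak_cover b uv; case: (b && _) => /=; lia.
apply/forallP=> v; apply/implyP=> uv; have := fP u v uv; rewrite /lexle.
by have [-> _] := tiebreak_cover b uv; case: (b && _) => /=; lia.
Qed.

Lemma ppartition_cover_converse (n : nat) (b : bool) (f : cell n -> nat) :
  reflect (forall u v, covers u v -> f u + ~~ (b && centre u) <= f v)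
          (ppartition (@covers n) (converse (tiebreak b)) f).
Proof.
apply: (iffP forallP) => fP u.
  move=> v uv; have /forallP/(_ v) := fP u; rewrite uv /lexle /converse.
  by have [_ ->] := tiebreak_cover b uv; case: (b && _) => /=; lia.
apply/forallP=> v; apply/implyP=> uv; have := fP u v uv; rewrite /lexle /converse.
by have [_ ->] := tiebreak_cover b uv; case: (b && _) => /=; lia.
Qed.

Lemma covers_down (n : nat) (u : cell n) : depth u + 1 < n ->
  exists2 w, covers w u & depth w = (depth u).+1.
Proof.
move=> lt_u; set i := frow n (crow u) (ccol u); set j := fcol n (crow u) (ccol u).
have dE : depth u = i + j by [].
have [w rw cw] := @cell_at n i.+1 j ltac:(lia) ltac:(lia) ltac:(lia).
have wu : covers w u.
  by rewrite /covers -/i -/j rw cw /adjacent /frow /fcol; case: ifP; lia.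
by exists w => //; apply: depth_cover.
Qed.

Lemma covers_up (n : nat) (u : cell n) : 0 < depth u ->
  exists2 v, covers u v & depth u = (depth v).+1.
Proof.
move=> gt_u; set i := frow n (crow u) (ccol u); set j := fcol n (crow u) (ccol u).
have dE : depth u = i + j by [].
have le_d := depth_le u.
have [[i' j'] /= ij] : {ij : nat * nat | adjacent i j ij.1 ij.2}.
  rewrite /adjacent; have [i0 | i_gt0] := posnP i; first by exists (i, j.-1) => /=; lia.
  by exists (i.-1, j) => /=; lia.
have [v rv cv] : {v : cell n | crow v = i' & ccol v = j'}.
  by apply: cell_at; move: ij; rewrite /adjacent; lia.
have uv : covers u v.
  move: ij; rewrite /covers -/i -/j rv cv /frow /fcol.
  by case: ifP; rewrite /adjacent; lia.
by exists v => //; apply: depth_cover.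
Qed.

(** Strictness propagates upwards from the last level above the antidiagonal: each
level raises the values by at least one. The truncated subtraction gives rank 0
to that level and to the centre. *)
Lemma rank_le (n : nat) (b : bool) (f : cell n -> nat) (u : cell n) :
  ppartition (@covers n) (converse (tiebreak b)) f -> n.-1 - depth u <= f u.
Proof.
move=> /ppartition_cover_converse fP.
have [k] := ubnP (n - depth u); elim: k u => // k IHk u lt_k.
have [lt_u | ge_u] := ltnP (depth u + 1) n; last lia.
have [w wu dw] := covers_down lt_u; have := IHk w ltac:(lia); have := fP w u wu.
have -> : centre w = false by rewrite centreE; lia.
by rewrite andbF; lia.
Qed.

Lemma corank_le (n m : nat) (b : bool) (f : cell n -> nat) (u : cell n) :
  ppartition (@covers n) (converse (tiebreak b)) f -> (forall v, f v <= m) ->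
  depth u < n -> f u + depth u <= m.
Proof.
move=> /ppartition_cover_converse fP f_le.
have [k] := ubnP (depth u); elim: k u => // k IHk u lt_k lt_u.
have [-> | gt0] := posnP (depth u); first by have := f_le u; lia.
have [v uv dv] := covers_up gt0; have := IHk v ltac:(lia) ltac:(lia).
have := fP u v uv; have -> : centre u = false by rewrite centreE; lia.
by rewrite andbF; lia.
Qed.

(** Subtracting the rank relaxes every strict relation between cells other than the
centre, and shortens the range by n - 1. The centre and its neighbours all have
rank 0, so a relation leaving the centre keeps its kind; it is weak for the
converse order exactly when it is strict for the original one, hence the
negated b. *)
Lemma npart_converse (n k : nat) (b : bool) : 0 < n ->
  npart (@covers n) (converse (tiebreak b)) (k + n)
    = npart (@covers n) (tiebreak (~~ b)) k.+1.
Proof.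
case: n => // n _; rewrite addnS.
pose down (f : {ffun cell n.+1 -> 'I_(k + n).+1}) : {ffun cell n.+1 -> 'I_k.+1} :=
  [ffun u => inord (f u - (n - depth u))].
pose up (g : {ffun cell n.+1 -> 'I_k.+1}) : {ffun cell n.+1 -> 'I_(k + n).+1} :=
  [ffun u => inord (g u + (n - depth u))].
have downE (f : {ffun cell n.+1 -> 'I_(k + n).+1}) u :
    ppartition (@covers n.+1) (converse (tiebreak b)) (fun x => f x) ->
    down f u = f u - (n - depth u) :> nat.
  move=> fP; rewrite ffunE inordK // ltnS.
  have f_le v : f v <= k + n by rewrite -ltnS.
  have [lt_u | ge_u] := ltnP (depth u) n.+1; first by have := corank_le fP f_le lt_u; lia.
  have [v uv dv] := covers_up (leq_trans (ltn0Sn n) ge_u); have := depth_le u => le_u.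
  have := corank_le fP f_le (ltac:(lia) : depth v < n.+1).
  by have := ppartition_cover_converse _ _ fP u v uv; lia.
have upE (g : {ffun cell n.+1 -> 'I_k.+1}) u : up g u = g u + (n - depth u) :> nat.
  by rewrite ffunE inordK // ltnS leq_add ?leq_subr // -ltnS.
apply: (card_mutual_inverse (f := down) (g := up)) => [f | g]; rewrite !inE => fP.
  split; last first.
    apply/ffunP=> u; apply/val_inj; rewrite /= upE downE // subnK //.
    exact: rank_le fP.
  apply/ppartition_cover => u v uv; rewrite !downE //.
  have := ppartition_cover_converse _ _ fP u v uv; have := depth_cover uv; rewrite centreE.
  have := depth_le u; case: eqP; case: (b) => /=; lia.
split; last first.
  apply/ffunP=> u; apply/val_inj; rewrite /= downE; first by rewrite upE addnK.
  apply/ppartition_cover_converse => {}u v uv; rewrite !upE.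
  have := ppartition_cover _ _ fP u v uv; have := depth_cover uv; rewrite centreE.
  have := depth_le u; case: eqP; case: (b) => /=; lia.
apply/ppartition_cover_converse => u v uv; rewrite !upE.
have := ppartition_cover _ _ fP u v uv; have := depth_cover uv; rewrite centreE.
have := depth_le u; case: eqP; case: (b) => /=; lia.
Qed.

(** The corner has rank n - 1, so a strict map takes n values at least. *)
Lemma npart_converse_small (n m : nat) (b : bool) : m < n ->
  npart (@covers n) (converse (tiebreak b)) m = 0.
Proof.
move=> lt_mn; apply/eqP; rewrite cards_eq0; apply/eqP/setP=> f; rewrite !inE.
apply/negbTE/negP => fP.
have [u ru cu] := @cell_at n 0 0 isT isT ltac:(lia).
have := rank_le u fP; have := ltn_ord (f u).
by rewrite /depth ru cu /frow /fcol /=; lia.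
Qed.

Lemma npart_no_centre (n m : nat) : odd n ->
  npart (@covers n) (tiebreak true) m = npart (@covers n) (tiebreak false) m.
Proof.
move=> odd_n; apply: eq_card => f; rewrite !inE.
have noc (u : cell n) : centre u = false.
  by apply/negbTE/negP; rewrite /centre; have [] := cellP u; lia.
by apply/ppartition_cover/ppartition_cover => fP u v /fP; rewrite noc.
Qed.

Lemma npart_gt0 (n k : nat) : 0 < npart (@covers n) (tiebreak false) k.+1.
Proof.
apply/card_gt0P; exists [ffun=> ord0]; rewrite inE; apply/ppartition_cover => u v _.
by rewrite !ffunE.
Qed.

Lemma card_cell (n : nat) : #|cell n| = dexp n.+1.
Proof.
set q := n.+1 * n.+1; have -> : dexp n.+1 = uphalf q by [].
have -> : #|cell n| = \sum_(i < n.+1) (n - i + (n <= i + i)).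
  rewrite card_sig -sum1_card.
  rewrite (eq_bigl (fun x => is_cell x)) // big_mkcond /=.
  rewrite -(pair_bigA_idem _ (fun i j : 'I_n.+1 => if is_cell (i, j) then 1 else 0)) //=.
  apply: eq_bigr => i _; have le_in : i <= n by rewrite -ltnS.
  have sumE m : \sum_(j < m) (if (i + j < n) || (i == j :> nat) then 1 else 0)
      = minn m (n - i) + ((i < m) && (n <= i + i)).
    elim: m => [|m IHm]; first by rewrite big_ord0 min0n.
    by rewrite big_ord_recr IHm /=; case: ifP; lia.
  by rewrite sumE; lia.
rewrite big_split /=.
have sum_gap m : m <= n.+1 -> (\sum_(i < m) (n - i)).*2 + m * m = m * n.*2.+1.
  elim: m => [|m IHm] lt_m; first by rewrite big_ord0.
  rewrite big_ord_recr /= !mulSn !mulnS; have := IHm (ltnW lt_m).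
  set S := \sum_(i < m) _; lia.
have sum_half m : \sum_(i < m) (n <= i + i) = m - uphalf n.
  by elim: m => [|m IHm]; rewrite ?big_ord0 // big_ord_recr /= IHm; lia.
rewrite sum_half; have := sum_gap n.+1 (leqnn _).
rewrite -/q; set S := \sum_(i < _) _.
have -> : n.+1 * n.*2.+1 = q + q - n.+1 by rewrite /q; lia.
have : odd q = odd n.+1 by rewrite oddM andbb.
have : n.+1 <= q by rewrite /q; lia.
move=> le_q odd_q; lia.
Qed.

(** * Complementary plane partitions as poset partitions *)

(** Membership in Q_a(h), for functions on natural numbers so that inequalities
between indices need no ordinals. The parameter b records the side of h on
which the centre lies, if there is a centre. *)
Record tau_complementary (n h : nat) (b : bool) (x : nat -> nat -> nat) : Prop :=
  TauComplementary {
    tc_bound : forall i j, i <= n -> j <= n -> x i j <= 2 * h;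
    tc_step : forall i j i' j', i <= n -> j <= n -> adjacent i j i' j' -> x i j <= x i' j';
    tc_compl : forall i j, i <= n -> j <= n -> i != j -> x i j + x (n - j) (n - i) = 2 * h;
    tc_centre : forall i, i + i = n -> (x i i < h) = b }.

Lemma tc_anti (n h : nat) (b : bool) (x : nat -> nat -> nat) (i j i' j' : nat) :
  tau_complementary n h b x -> i <= i' <= n -> j <= j' <= n -> x i' j' <= x i j.
Proof.
case=> _ step _ _ /andP[le_i le_i'] /andP[le_j le_j'].
have : x i j' <= x i j.
  elim: j' le_j le_j' => [|j' IHj] le_j le_j'; first by (have -> : j = 0 by lia).
  have [-> // | ne_j] := eqVneq j j'.+1.
  by apply: leq_trans (IHj ltac:(lia) ltac:(lia)); apply: step; rewrite /adjacent; lia.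
apply: leq_trans; elim: i' le_i le_i' => [|i' IHi] le_i le_i'.
  by (have -> : i = 0 by lia).
have [-> // | ne_i] := eqVneq i i'.+1.
by apply: leq_trans (IHi ltac:(lia) ltac:(lia)); apply: step; rewrite /adjacent; lia.
Qed.

(** Off the diagonal, an entry and its mirror image add up to 2h and the upper one
is the larger. A diagonal entry dominates its right neighbour, which is off the
diagonal and still weakly above the antidiagonal. *)
Lemma tc_above (n h : nat) (b : bool) (x : nat -> nat -> nat) (i j : nat) :
  tau_complementary n h b x -> i <= n -> j <= n ->
  (i + j < n) || (i + j == n) && (i != j) -> h <= x i j.
Proof.
move=> xP le_i le_j ij; have [ne_ij | eq_ij] := boolP (i != j).
  have := tc_compl xP le_i le_j ne_ij.
  by have := @tc_anti _ _ _ _ i j (n - j) (n - i) xP ltac:(lia) ltac:(lia); lia.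
have := @tc_compl _ _ _ _ xP i i.+1 ltac:(lia) ltac:(lia) ltac:(lia).
have := @tc_anti _ _ _ _ i i.+1 (n - i.+1) (n - i) xP ltac:(lia) ltac:(lia).
have := @tc_anti _ _ _ _ i j i i.+1 xP ltac:(lia) ltac:(lia); lia.
Qed.

Lemma tc_below (n h : nat) (b : bool) (x : nat -> nat -> nat) (i j : nat) :
  tau_complementary n h b x -> i <= n -> j <= n ->
  (n < i + j) || (i + j == n) && (i != j) -> x i j <= h.
Proof.
move=> xP le_i le_j ij; have [ne_ij | eq_ij] := boolP (i != j).
  have := tc_compl xP le_i le_j ne_ij.
  by have := @tc_anti _ _ _ _ (n - j) (n - i) i j xP ltac:(lia) ltac:(lia); lia.
have := @tc_compl _ _ _ _ xP i i.-1 ltac:(lia) ltac:(lia) ltac:(lia).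
have := @tc_anti _ _ _ _ (n - i.-1) (n - i) i i.-1 xP ltac:(lia) ltac:(lia).
have := @tc_anti _ _ _ _ i i.-1 i j xP ltac:(lia) ltac:(lia); lia.
Qed.

(** The distance to h, lowered by one at a centre that lies below h: the possible
values of such a centre then start at 0. *)
Definition deviation (n h : nat) (x : nat -> nat -> nat) (i j : nat) : nat :=
  (x i j - h) + (h - x i j) - ((i + j == n) && (x i j < h)).

(** Each cell can be read as an entry of x in its own position or, off the diagonal,
as 2h minus the entry in the mirror position. Of two adjacent folded positions
one is off the diagonal, so that both cells can be read in the same half of the
matrix, where the monotonicity of x compares them. *)
Lemma deviation_cover (n h : nat) (b : bool) (x : nat -> nat -> nat) (u v : cell n) :
  tau_complementary n h b x -> covers u v ->
  deviation n h x (crow u) (ccol u) + (b && centre u)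
    <= deviation n h x (crow v) (ccol v).
Proof.
move=> xP; have [ru cu uP] := cellP u; have [rv cv vP] := cellP v.
rewrite /covers /centre /deviation.
move: (crow u) (ccol u) (crow v) (ccol v) ru cu uP rv cv vP
  => i j i' j' le_i le_j ijP le_i' le_j' ijP'.
rewrite /frow /fcol => adj.
have anti k l k' l' : k <= k' <= n -> l <= l' <= n -> x k' l' <= x k l.
  by move=> kk ll; apply: tc_anti xP kk ll.
have compl k l : k <= n -> l <= n -> k != l -> x k l + x (n - l) (n - k) = 2 * h.
  by apply: (tc_compl xP).
have [lt_uv | ge_uv] := leqP (i' + j') n.
  have [le_ij | gt_ij] := leqP (i + j) n; move: adj; rewrite /adjacent lt_uv.
    rewrite le_ij => adj; have := anti i' j' i j ltac:(lia) ltac:(lia).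
    (* Both cells are at or above the antidiagonal; only u can be the centre. *)
    have [eq_n | ne_n] := eqVneq (i + j) n; last first.
      have := @tc_above _ _ _ _ i j xP ltac:(lia) ltac:(lia) ltac:(lia).
      have := @tc_above _ _ _ _ i' j' xP ltac:(lia) ltac:(lia) ltac:(lia).
      by case: b xP => xP; lia.
    have eq_ij : i = j by lia.
    (* The mirror image of v is a neighbour of the centre and bounds it from below. *)
    subst j; have := tc_centre xP eq_n.
    have := compl i' j' ltac:(lia) ltac:(lia) ltac:(lia).
    have := anti i i (n - j') (n - i') ltac:(lia) ltac:(lia).
    have := @tc_above _ _ _ _ i' j' xP ltac:(lia) ltac:(lia) ltac:(lia).
    by case: b xP => xP; case: ltnP => //; lia.
  have -> : (i + j <= n) = false by lia.
  move=> adj; have eq_ij : i = j by lia.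
  have := compl i' j' ltac:(lia) ltac:(lia) ltac:(lia).
  have := anti i j (n - j') (n - i') ltac:(lia) ltac:(lia).
  have := @tc_below _ _ _ _ i j xP ltac:(lia) ltac:(lia) ltac:(lia).
  have := @tc_above _ _ _ _ i' j' xP ltac:(lia) ltac:(lia) ltac:(lia).
  by case: b xP => xP; lia.
have eq_ij' : i' = j' by lia.
move: adj; rewrite /adjacent; have -> : (i' + j' <= n) = false by lia.
have [le_ij | gt_ij] := leqP (i + j) n => adj; last by lia.
have := compl i j ltac:(lia) ltac:(lia) ltac:(lia).
have := anti (n - j) (n - i) i' j' ltac:(lia) ltac:(lia).
have := @tc_below _ _ _ _ i' j' xP ltac:(lia) ltac:(lia) ltac:(lia).
have := @tc_above _ _ _ _ i j xP ltac:(lia) ltac:(lia) ltac:(lia).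
by case: b xP => xP; lia.
Qed.

(** Extension by 0, the value required on the antidiagonal off the centre, where
the entries of the matrix equal h. *)
Definition cell_value (n : nat) (f : cell n -> nat) (i j : nat) : nat :=
  if [pick u : cell n | (crow u == i) && (ccol u == j)] is Some u then f u else 0.

Lemma cell_valueE (n : nat) (f : cell n -> nat) (u : cell n) :
  cell_value f (crow u) (ccol u) = f u.
Proof.
rewrite /cell_value; case: pickP => [v /andP[/eqP rv /eqP cv] | /(_ u)].
  by rewrite (cell_inj rv cv).
by rewrite !eqxx.
Qed.

Lemma cell_value0 (n : nat) (f : cell n -> nat) (i j : nat) :
  i + j = n -> i != j -> cell_value f i j = 0.
Proof.
move=> ij ne_ij; rewrite /cell_value; case: pickP => // u /andP[/eqP ru /eqP cu].
by have [_ _] := cellP u; rewrite ru cu; lia.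
Qed.

Definition fill (n : nat) (f : cell n -> nat) (i j : nat) : nat :=
  if (i + j <= n) || (i == j) then cell_value f i j
  else cell_value f (n - j) (n - i).

(** Inverse of taking deviations: entries move up from h above the antidiagonal and
down from h below it, and b gives the direction at the centre, where going down
undoes the lowering by one. *)
Definition restore (n h : nat) (b : bool) (f : cell n -> nat) (i j : nat) : nat :=
  if (i + j <= n) && ~~ [&& b, i + j == n & i == j] then h + fill f i j
  else h - fill f i j - (i + j == n).

Lemma fill_cell (n : nat) (f : cell n -> nat) (u : cell n) :
  fill f (crow u) (ccol u) = f u.
Proof.
by rewrite /fill cell_valueE; case: ifP => //; have [_ _] := cellP u; lia.
Qed.

(** Reduces inequalities between entries of the matrix to relations between cells:
the only positions without a cell are those of the antidiagonal off the centre,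
where the deviation vanishes. *)
Lemma fillP (n : nat) (f : cell n -> nat) (i j : nat) : i <= n -> j <= n ->
  [/\ i + j = n, i != j & fill f i j = 0] \/
  exists u : cell n,
    [/\ fill f i j = f u, frow n (crow u) (ccol u) = frow n i j,
        fcol n (crow u) (ccol u) = fcol n i j & centre u = [&& i + j == n & i == j]].
Proof.
move=> le_i le_j; have [/andP[/eqP ij ne_ij] | Nij] := boolP ((i + j == n) && (i != j)).
  by left; rewrite /fill ij leqnn cell_value0.
right; have [ij | Nij'] := boolP ((i + j < n) || (i == j)).
  have [u <- <-] := cell_at le_i le_j ij.
  by exists u; split; rewrite ?fill_cell // /centre; have [? ? ?] := cellP u; lia.
have [u ru cu] := @cell_at n (n - j) (n - i) ltac:(lia) ltac:(lia) ltac:(lia).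
exists u; rewrite /fill /centre /frow /fcol -cell_valueE ru cu.
have -> : (i + j <= n) || (i == j) = false by lia.
have -> : (n - j + (n - i) <= n) by lia.
have -> : (i + j <= n) = false by lia.
by split; lia.
Qed.

Lemma fill_step (n : nat) (b : bool) (f : cell n -> nat) (i j i' j' : nat) :
  ppartition (@covers n) (tiebreak b) f ->
  i <= n -> j <= n -> i' <= n -> j' <= n ->
  adjacent (frow n i j) (fcol n i j) (frow n i' j') (fcol n i' j') ->
  fill f i j + [&& b, i + j == n & i == j] <= fill f i' j'.
Proof.
move=> /ppartition_cover fP le_i le_j le_i' le_j' adj.
have [[ij ne_ij ->] | [u [-> ru cu cenu]]] := fillP f le_i le_j.
  by rewrite ij eqxx (negbTE ne_ij) /= andbF.
have [[ij' ne_ij' _] | [v [-> rv cv _]]] := fillP f le_i' le_j'.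
  move: adj; rewrite /adjacent /frow /fcol ij' leqnn; case: ifP; lia.
by rewrite -cenu; apply: fP; rewrite /covers ru cu rv cv.
Qed.

Lemma fill_compl (n : nat) (f : cell n -> nat) (i j : nat) :
  i <= n -> j <= n -> i != j -> fill f (n - j) (n - i) = fill f i j.
Proof.
move=> le_i le_j ne_ij; rewrite /fill.
have -> : n - (n - i) = i by lia.
have -> : n - (n - j) = j by lia.
case: ifP; case: ifP => //; try lia.
move=> H1 H2; (have -> : n - j = i by lia); (have -> : n - i = j by lia).
by [].
Qed.

Lemma fill_le (n h : nat) (f : cell n -> nat) (i j : nat) :
  (forall u, f u <= h) -> i <= n -> j <= n -> fill f i j <= h.
Proof.
move=> f_le le_i le_j.
by have [[_ _ ->] | [u [-> _ _ _]]] := fillP f le_i le_j.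
Qed.

(** For b true, restoring the centre subtracts one more than its value from h; a
neighbour, which exists for n > 0, leaves room for this. *)
Lemma fill_centre (n h i : nat) (b : bool) (f : cell n -> nat) :
  0 < n -> (forall u, f u <= h) -> ppartition (@covers n) (tiebreak b) f ->
  i + i = n -> fill f i i + b <= h.
Proof.
move=> n_gt0 f_le fP ii.
have adj : adjacent (frow n i i) (fcol n i i) (frow n i i.-1) (fcol n i i.-1).
  by rewrite /adjacent /frow /fcol; case: ifP; case: ifP; lia.
have := @fill_step n b f i i i i.-1 fP ltac:(lia) ltac:(lia) ltac:(lia) ltac:(lia) adj.
rewrite ii !eqxx !andbT => /leq_trans; apply.
by apply: fill_le => //; lia.
Qed.

Lemma restore_tc (n h : nat) (b : bool) (f : cell n -> nat) :
  0 < n -> (forall u, f u <= h) -> ppartition (@covers n) (tiebreak b) f ->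
  tau_complementary n h b (restore h b f).
Proof.
move=> n_gt0 f_le fP; have F_le i j : i <= n -> j <= n -> fill f i j <= h by apply: fill_le.
split=> [i j le_i le_j | i j i' j' le_i le_j adj | i j le_i le_j ne_ij | i ii].
- by have := F_le i j le_i le_j; rewrite /restore; case: ifP; lia.
- have [le_i' le_j'] : i' <= n /\ j' <= n by move: adj; rewrite /adjacent; lia.
  have := F_le i j le_i le_j; have := F_le i' j' le_i' le_j'.
  have [ij | ij] := leqP (i + j) n.
    have := @fill_step n b f i j i' j' fP le_i le_j le_i' le_j'.
    have ij' : i' + j' <= n by move: adj; rewrite /adjacent; lia.
    rewrite /frow /fcol ij ij'.
    move=> /(_ adj); move: adj; rewrite /restore ij ij' /adjacent /=.
    by case: b fP => fP /=; do ?case: ifP; lia.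
  have := @fill_step n b f i' j' i j fP le_i' le_j' le_i le_j.
  have adj' : adjacent (frow n i' j') (fcol n i' j') (frow n i j) (fcol n i j).
    by move: adj; rewrite /adjacent /frow /fcol; case: ifP; case: ifP; lia.
  move=> /(_ adj'); move: adj; rewrite /restore (ltn_geF ij) /adjacent /=.
  by case: b fP => fP /=; do ?case: ifP; lia.
- have := F_le i j le_i le_j; rewrite /restore fill_compl //.
  have [ij | ne_n] := eqVneq (i + j) n; last by do ?case: ifP; lia.
  have -> : fill f i j = 0 by rewrite /fill ij leqnn cell_value0.
  by do ?case: ifP; lia.
- have := fill_centre n_gt0 f_le fP ii.
  by rewrite /restore ii leqnn !eqxx andbT; case: b fP => fP /=; lia.
Qed.

Lemma deviation_restore (n h : nat) (b : bool) (f : cell n -> nat) (u : cell n) :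
  0 < n -> (forall u, f u <= h) -> ppartition (@covers n) (tiebreak b) f ->
  deviation n h (restore h b f) (crow u) (ccol u) = f u.
Proof.
move=> n_gt0 f_le fP; have := f_le u; have [le_i le_j uP] := cellP u.
have := fun ii => @fill_centre n h (crow u) b f n_gt0 f_le fP ii.
rewrite /deviation /restore fill_cell.
have [eq_n | ne_n] := eqVneq (crow u + ccol u) n; last first.
  by move=> _; case: b fP => fP; case: ifP; lia.
have eq_rc : crow u = ccol u by lia.
rewrite -eq_rc in eq_n *; move=> /(_ eq_n); rewrite {1}eq_rc -{1}eq_rc.
have -> : fill f (crow u) (crow u) = f u by rewrite -{1}[f u]fill_cell eq_rc.
by rewrite eq_n leqnn eqxx; case: b fP => fP /=; lia.
Qed.

Lemma restore_deviation (n h : nat) (b : bool) (x : nat -> nat -> nat)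
    (f : cell n -> nat) (i j : nat) :
  tau_complementary n h b x ->
  (forall u, f u = deviation n h x (crow u) (ccol u)) ->
  i <= n -> j <= n -> restore h b f i j = x i j.
Proof.
move=> xP fE le_i le_j.
have devP : fill f i j = deviation n h x i j.
  rewrite /fill; have [ij | Nij] := boolP ((i + j <= n) || (i == j)).
    have [/andP[/eqP eq_n ne_ij] | Nij] := boolP ((i + j == n) && (i != j)).
      rewrite cell_value0 // /deviation.
      have := @tc_above _ _ _ _ i j xP ltac:(lia) ltac:(lia) ltac:(lia).
      have := @tc_below _ _ _ _ i j xP ltac:(lia) ltac:(lia) ltac:(lia).
      lia.
    have [u <- <-] := @cell_at n i j le_i le_j ltac:(lia).
    by rewrite cell_valueE fE.
  have [u ru cu] := @cell_at n (n - j) (n - i) ltac:(lia) ltac:(lia) ltac:(lia).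
  rewrite -ru -cu cell_valueE fE ru cu /deviation.
  have := @tc_compl _ _ _ _ xP i j ltac:(lia) ltac:(lia) ltac:(lia).
  lia.
rewrite /restore devP /deviation; have x_le := tc_bound xP le_i le_j.
have [lt_ij | gt_ij | eq_n] := ltngtP (i + j) n.
- have := @tc_above _ _ _ _ i j xP ltac:(lia) ltac:(lia) ltac:(lia).
  by case: b xP => xP /=; lia.
- have := @tc_below _ _ _ _ i j xP ltac:(lia) ltac:(lia) ltac:(lia).
  by case: b xP => xP /=; lia.
- have [eq_ij | ne_ij] := eqVneq i j; last first.
    have := @tc_above _ _ _ _ i j xP ltac:(lia) ltac:(lia) ltac:(lia).
    have := @tc_below _ _ _ _ i j xP ltac:(lia) ltac:(lia) ltac:(lia).
    by case: b xP => xP /=; lia.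
  by subst j; have := tc_centre xP eq_n; case: b xP => xP /=; lia.
Qed.

Definition entry (n H : nat) (p : 'M['I_H.+1]_n.+1) (i j : nat) : nat :=
  p (inord i) (inord j).

Definition low_centre (n h : nat) (p : 'M['I_(2 * h).+1]_n.+1) : bool :=
  [exists i : 'I_n.+1, (i + i == n) && (p i i < h)].

Lemma entryE (n H : nat) (p : 'M['I_H.+1]_n.+1) (i j : 'I_n.+1) : entry p i j = p i j.
Proof. by rewrite /entry !inord_val. Qed.

Lemma Qset_tc (n h : nat) (p : 'M['I_(2 * h).+1]_n.+1) :
  p \in Qset n.+1 h -> tau_complementary n h (low_centre p) (entry p).
Proof.
rewrite inE => /andP[/andP[/forallP stepr /forallP stepc] /forallP compl].
have nE i : i <= n -> exists k : 'I_n.+1, i = k by move=> le_i; exists (inord i); rewrite inordK.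
split=> [i j _ _ | i j i' j' le_i le_j adj | i j le_i le_j ne_ij | i ii].
- by rewrite -ltnS ltn_ord.
- have [le_i' le_j'] : i' <= n /\ j' <= n by move: adj; rewrite /adjacent; lia.
  have [k ik] := nE i le_i; have [l jl] := nE j le_j.
  have [k' ik'] := nE i' le_i'; have [l' jl'] := nE j' le_j'.
  move: adj; rewrite ik jl ik' jl' !entryE => /orP[] /andP[/eqP eq_i /eqP eq_j].
    have /forallP/(_ k)/forallP/(_ l)/implyP := stepr k'.
    by rewrite eq_i (val_inj eq_j : l = l') eqxx => /(_ isT).
  have /forallP/(_ l')/forallP/(_ l)/implyP := stepc k'.
  by rewrite eq_j (val_inj eq_i : k = k') eqxx => /(_ isT).
- have [k ik] := nE i le_i; have [l jl] := nE j le_j.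
  have ne_kl : k != l by apply: contra ne_ij => /eqP eq_kl; rewrite ik jl eq_kl.
  have /forallP/(_ l)/implyP/(_ ne_kl)/eqP kl := compl k.
  by apply: etrans kl; rewrite ik jl /= -!entryE /= !subSS.
- have [k ik] := nE i ltac:(lia); rewrite ik entryE.
  apply/idP/existsP => [lt_h | [l /andP[/eqP ll lt_h]]].
    by exists k; rewrite lt_h andbT; apply/eqP; lia.
  suff -> : k = l by [].
  by apply: val_inj => /=; lia.
Qed.

Lemma tc_Qset (n h : nat) (b : bool) (p : 'M['I_(2 * h).+1]_n.+1) :
  tau_complementary n h b (entry p) -> p \in Qset n.+1 h.
Proof.
move=> xP; have leE (i : 'I_n.+1) : i <= n by rewrite -ltnS.
rewrite inE; apply/andP; split; first (apply/andP; split).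
- apply/forallP=> i; apply/forallP=> i'; apply/forallP=> j; apply/implyP=> /eqP ii.
  by rewrite -!entryE; apply: (tc_step xP) => //; rewrite /adjacent ?ii ?eqxx.
- apply/forallP=> i; apply/forallP=> j; apply/forallP=> j'; apply/implyP=> /eqP jj.
  by rewrite -!entryE; apply: (tc_step xP) => //; rewrite /adjacent ?jj ?eqxx ?orbT.
- apply/forallP=> i; apply/forallP=> j; apply/implyP=> ne_ij; apply/eqP.
  apply: etrans (tc_compl xP (leE i) (leE j) ne_ij).
  by rewrite -!entryE /= !subSS.
Qed.

(** Taking deviations and restoring the matrix are mutually inverse. The value true
of b is only possible when there is a centre, that is for n even. *)
Lemma card_Qset_centre (n h : nat) (b : bool) : 0 < n -> b ==> ~~ odd n ->
  #|[set p in Qset n.+1 h | low_centre p == b]| = npart (@covers n) (tiebreak b) h.+1.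
Proof.
move=> n_gt0 bP.
pose enc (p : 'M['I_(2 * h).+1]_n.+1) : {ffun cell n -> 'I_h.+1} :=
  [ffun u => inord (deviation n h (entry p) (crow u) (ccol u))].
pose dec (f : {ffun cell n -> 'I_h.+1}) : 'M['I_(2 * h).+1]_n.+1 :=
  (\matrix_(i, j) inord (restore h b (fun u => f u) i j))%R.
have encE p u : p \in Qset n.+1 h ->
    enc p u = deviation n h (entry p) (crow u) (ccol u) :> nat.
  move=> /Qset_tc pP; rewrite ffunE inordK //.
  have [le_i le_j _] := cellP u; have := tc_bound pP le_i le_j.
  by rewrite /deviation ltnS; lia.
have f_le (f : {ffun cell n -> 'I_h.+1}) u : f u <= h by rewrite -ltnS.
have decE (f : {ffun cell n -> 'I_h.+1}) i j :
    ppartition (@covers n) (tiebreak b) (fun u => f u) ->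
    i <= n -> j <= n -> entry (dec f) i j = restore h b (fun u => f u) i j.
  move=> fP le_i le_j; have rP := restore_tc n_gt0 (f_le f) fP.
  by rewrite /entry mxE !inordK // ltnS; apply: (tc_bound rP).
apply: (card_mutual_inverse (f := enc) (g := dec)) => [p | f].
  rewrite [p \in _]in_set => /andP[Qp /eqP bp].
  have pP := Qset_tc Qp; rewrite bp in pP.
  split.
    by rewrite inE; apply/ppartition_cover => u v uv; rewrite !encE //; apply: deviation_cover.
  apply/matrixP=> i j; rewrite mxE; apply/val_inj => /=.
  have [le_i le_j] : i <= n /\ j <= n by split; rewrite -ltnS ltn_ord.
  rewrite (restore_deviation pP _ le_i le_j) ?entryE ?inord_val // => u.
  exact: encE.
rewrite [f \in _]in_set => fP; have rP := restore_tc n_gt0 (f_le f) fP.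
have dP : tau_complementary n h b (entry (dec f)).
  case: rP => r1 r2 r3 r4; split=> [i j ? ? | i j i' j' ? ? adj | i j ? ? ? | i ii].
  - by rewrite decE // r1.
  - have [? ?] : i' <= n /\ j' <= n by move: adj; rewrite /adjacent; lia.
    by rewrite !decE // r2.
  - by rewrite !decE ?r3 //; lia.
  - by rewrite decE ?r4 //; lia.
have Qd := tc_Qset dP; rewrite in_set Qd; split.
  have [b_true | b_false] := boolP (~~ odd n); last first.
    have := Qset_tc Qd => dP'; have -> : b = false by case: (b) bP b_false => //= ->.
    apply/eqP/negbTE/existsPn => i; apply/negP => /andP[/eqP ii _].
    by rewrite -ii addnn odd_double in b_false.
  have nn : n./2 + n./2 = n by lia.
  exact/eqP/(etrans (esym (tc_centre (Qset_tc Qd) nn)) (tc_centre dP nn)).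
apply/ffunP=> u; apply/val_inj; rewrite /= encE //.
have [le_i le_j _] := cellP u.
rewrite /deviation !decE // -/(deviation n h (restore h b (fun u => f u)) (crow u) (ccol u)).
exact: deviation_restore.
Qed.

Lemma Qcount_npart (n h : nat) : 0 < n ->
  Qcount n.+1 h = npart (@covers n) (tiebreak false) h.+1
     + (if odd n then 0 else npart (@covers n) (tiebreak true) h.+1).
Proof.
move=> n_gt0; rewrite /Qcount.
rewrite -(cardsID [set p | @low_centre n h p == false] (Qset n.+1 h)).
rewrite -(@card_Qset_centre n h false n_gt0) //.
congr (_ + _); first by apply: eq_card => p; rewrite !inE.
case: ifP => odd_n; last first.
  rewrite -(@card_Qset_centre n h true n_gt0) ?odd_n //; apply: eq_card => p; rewrite !inE.
  by rewrite andbC; case: low_centre.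
apply/eqP; rewrite cards_eq0; apply/eqP/setP => p; rewrite !inE.
have -> : low_centre p = false; last by [].
apply/negbTE/existsPn => i; apply/negP => /andP[/eqP ii _].
by rewrite -ii addnn odd_double in odd_n.
Qed.

Import Order.TTheory GRing.Theory Num.Theory.
Local Open Scope ring_scope.

(** * Reciprocity for the counting polynomial *)

Lemma horner_binom_poly (p : {poly rat}) (n : nat) (x : rat) :
  (binom_poly p n).[x] = (n`!%:R)^-1 * \prod_(i < n) (p.[x] - i%:R).
Proof.
rewrite hornerZ horner_prod; congr (_ * _); apply: eq_bigr => i _.
by rewrite hornerD hornerN -[i%:R in LHS]polyC_natr hornerC.
Qed.

Lemma prod_falling (N n : nat) :
  \prod_(i < n) (N%:R - i%:R) = (N ^_ n)%:R :> rat.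
Proof.
elim: n => [|n IHn]; first by rewrite big_ord0 ffactn0.
rewrite big_ord_recr /= IHn ffactnSr natrM.
have [le_nN | lt_Nn] := leqP n N; first by rewrite natrB.
by rewrite ffact_small // !mul0r.
Qed.

Lemma horner_shifted_binom_poly (k n m : nat) :
  (binom_poly ('X + k%:R) n).[m%:R] = 'C(m + k, n)%:R.
Proof.
rewrite horner_binom_poly hornerD hornerX -polyC_natr hornerC -natrD prod_falling.
by rewrite -bin_ffact natrM mulrC mulfK // pnatr_eq0 -lt0n fact_gt0.
Qed.

(** Reversing the order of the n factors shows that replacing y by n - 1 - y changes
binomial(y, n) by the sign (-1)^n. *)
Lemma horner_shifted_binom_polyN (k k' n m : nat) : (k + k' = n.-1)%N -> (0 < n)%N ->
  (binom_poly ('X + k%:R) n).[- m%:R] = (-1) ^+ n * 'C(m + k', n)%:R.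
Proof.
move=> def_n n_gt0; rewrite -(horner_shifted_binom_poly k' n m) !horner_binom_poly.
rewrite mulrCA; congr (_ * _); rewrite !hornerD !hornerX -!polyC_natr !hornerC.
rewrite -[X in (-1) ^+ X]card_ord -prodrN (reindex_inj rev_ord_inj) /=.
apply: eq_bigr => i _; have -> : (n - i.+1 = k + k' - i)%N by lia.
by rewrite natrB ?natrD; [ring | have := ltn_ord i; lia].
Qed.

Lemma shifted_binom_poly_lead (k n : nat) :
  (size (binom_poly ('X + k%:R) n) <= n.+1)%N /\
  (binom_poly ('X + k%:R) n)`_n = (n`!%:R)^-1.
Proof.
rewrite /binom_poly; set p := \prod_(i < n) _.
have def_p : p = \prod_(i < n) ('X - (i%:R - k%:R)%:P).
  by apply: eq_bigr => i _; rewrite rmorphB /= !polyC_natr opprB addrA.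
have sz_p : size p = n.+1 by rewrite def_p size_prod_XsubC /index_enum -enumT size_enum_ord.
have lead_p : p`_n = 1.
  by have := monic_prod_XsubC (index_enum 'I_n) predT (fun i : 'I_n => i%:R - k%:R : rat);
    rewrite -def_p => /monicP; rewrite lead_coefE sz_p.
by rewrite coefZ lead_p mulr1 (leq_trans (size_scale_leq _ _)) ?sz_p.
Qed.

Lemma shifted_binom_poly_int (k n : nat) :
  n`!%:R *: binom_poly ('X + k%:R) n
    = map_poly intr (\prod_(i < n) ('X + k%:R - i%:R) : {poly int}).
Proof.
rewrite /binom_poly scalerA divff ?scale1r; last by rewrite pnatr_eq0 -lt0n fact_gt0.
rewrite rmorph_prod; apply: eq_bigr => i _.
by rewrite rmorphB rmorphD /= map_polyX !rmorph_nat.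
Qed.

(** The polynomial is the sum of binomial(m + k, n) over linear extensions, k being
the number of ascents. Linear extensions do not depend on e, and their number
divided by n! is the leading coefficient, so that one partition is enough to
know the degree. *)
Lemma npart_polynomial (T : finType) (r e : rel T) (x0 : T) : total_order e ->
  exists P : {poly rat},
    [/\ forall m, P.[m%:R] = (npart r e m)%:R,
        forall m, P.[- m%:R] = (-1) ^+ #|T| * (npart r (converse e) m)%:R,
        (size P <= #|T|.+1)%N,
        0 <= P`_#|T| /\ (forall m, (0 < npart r e m)%N -> 0 < P`_#|T|) &
        exists G : {poly int}, #|T|`!%:R *: P = map_poly intr G].
Proof.
move=> ordE; pose n := #|T|; have n_gt0 : (0 < n)%N by apply/card_gt0P; exists x0.
pose L (t : n.-tuple T) := perm_eq t (enum T) && linext r t.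
pose P : {poly rat} := \sum_(t | L t) binom_poly ('X + (ascents e x0 t n.-1)%:R) n.
have lead_P : P`_n = #|[pred t | L t]|%:R * (n`!%:R)^-1.
  rewrite coef_sum (eq_bigr (fun=> (n`!%:R)^-1)) => [|t _]; last first.
    by have [_ ->] := shifted_binom_poly_lead (ascents e x0 t n.-1) n.
  by rewrite sumr_const mulr_natl.
exists P; split; rewrite -/n.
- move=> m; rewrite (npart_sum_linext r x0 m ordE) horner_sum natr_sum.
  by apply: eq_bigr => t _; rewrite horner_shifted_binom_poly.
- move=> m; rewrite (npart_sum_linext r x0 m (total_order_converse ordE)).
  rewrite horner_sum natr_sum big_distrr /=; apply: eq_bigr => t /andP[te _].
  apply: horner_shifted_binom_polyN => //; apply: ascents_converse => //.
    by rewrite (perm_uniq te) enum_uniq.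
  by rewrite size_tuple prednK.
- apply: (leq_trans (size_sum _ _ _)); apply/bigmax_leqP => t _.
  by have [] := shifted_binom_poly_lead (ascents e x0 t n.-1) n.
- rewrite lead_P; split=> [|m]; first by rewrite mulr_ge0 ?invr_ge0 ?ler0n.
  rewrite (npart_sum_linext r x0 m ordE) => sum_gt0.
  rewrite mulr_gt0 ?invr_gt0 ?ltr0n ?fact_gt0 //; apply/card_gt0P.
  have [t Lt | L0] := pickP L; first by exists t.
  by rewrite big_pred0 // in sum_gt0.
- exists (\sum_(t | L t) \prod_(i < n) ('X + (ascents e x0 t n.-1)%:R - i%:R)).
  rewrite scaler_sumr rmorph_sum; apply: eq_bigr => t _.
  exact: shifted_binom_poly_int.
Qed.

(** Counting maps to {0, ..., h} evaluates the polynomial of [npart_polynomial] at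
h + 1; hence the value of Q at -k is given by maps to k - 1 values. *)
Lemma Qcount_polynomial (n : nat) : (0 < n)%N ->
  exists Q : {poly rat},
    [/\ extends_Qcount n.+1 Q,
        size Q = (dexp n.+1).+1,
        forall h, Q.[- (n.+1 + h)%:R] = (-1) ^+ dexp n.+1 * Q.[h%:R],
        forall k, (0 < k <= n)%N -> Q.[- k%:R] = 0 &
        exists G : {poly int}, (dexp n.+1)`!%:R *: Q = map_poly intr G].
Proof.
move=> n_gt0; have [x0 _ _] := @cell_at n 0 0 isT isT ltac:(lia).
have [P0 [P0E P0N szP0 [_ P0_gt0] [G0 G0E]]] :=
  npart_polynomial (@covers n) x0 (@tiebreak_total_order n false).
have [P1 [P1E P1N szP1 [P1_ge0 _] [G1 G1E]]] :=
  npart_polynomial (@covers n) x0 (@tiebreak_total_order n true).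
rewrite card_cell in P0N szP0 P0_gt0 G0E P1N szP1 P1_ge0 G1E.
set d := dexp n.+1 in P0N szP0 P0_gt0 G0E P1N szP1 P1_ge0 G1E *.
pose P := P0 + (if odd n then 0 else P1).
have QE h : (P \Po ('X + 1)).[h%:R] = (Qcount n.+1 h)%:R.
  have shiftE : ('X + 1 : {poly rat}).[h%:R] = h.+1%:R by rewrite !hornerE natr1.
  rewrite horner_comp shiftE Qcount_npart // hornerD P0E natrD.
  by case: (odd n); rewrite ?horner0 ?P1E.
have PN m : P.[- m%:R] = (-1) ^+ d * (npart (@covers n) (converse (tiebreak false)) m
    + if odd n then 0 else npart (@covers n) (converse (tiebreak true)) m)%:R.
  rewrite hornerD P0N natrD mulrDr.
  by case: (odd n); rewrite ?horner0 ?mulr0 // P1N.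
have QN k : (0 < k)%N -> (P \Po ('X + 1)).[- k%:R] = P.[- k.-1%:R].
  case: k => // k _; rewrite horner_comp; congr (P.[_]).
  by rewrite !hornerE -natr1 opprD subrK.
exists (P \Po ('X + 1)); split=> // [|h|k /andP[k_gt0 le_kn]|].
- have sz1 : size ('X + 1 : {poly rat}) = 2%N by rewrite -polyC1 size_XaddC.
  rewrite size_comp_poly2 //; apply/eqP; rewrite eqn_leq; apply/andP; split.
    apply: leq_trans (size_polyD _ _) _; rewrite geq_max szP0.
    by case: (odd n); rewrite ?size_poly0.
  have : 0 < P`_d.
    rewrite coefD ltr_pwDl ?(P0_gt0 1%N) ?npart_gt0 //.
    by case: (odd n); rewrite ?coef0.
  by apply: contraTT; rewrite -leqNgt => /leq_sizeP/(_ d (leqnn d)) ->; rewrite ltxx.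
- rewrite QN // QE addSn /= addnC PN !npart_converse // Qcount_npart //=.
  (* Without a centre both regimes coincide; otherwise they are exchanged. *)
  case: ifP => odd_n; first by rewrite npart_no_centre.
  by rewrite addnC.
- rewrite QN // PN !npart_converse_small; try lia.
  by case: ifP; rewrite ?mulr0.
- exists ((G0 + (if odd n then 0 else G1)) \Po ('X + 1)).
  have mapX1 : map_poly intr ('X + 1) = 'X + 1 :> {poly rat}.
    by rewrite rmorphD /= map_polyX rmorph1.
  rewrite map_comp_poly mapX1 -comp_polyZ; congr (_ \Po _).
  rewrite scalerDr G0E [RHS]rmorphD /=; congr (_ + _).
  by case: (odd n); rewrite ?rmorph0 ?scaler0.
Qed.

(** * Factorization and denominators *)

Lemma poly_eq_on_nat (p q : {poly rat}) : (forall h : nat, p.[h%:R] = q.[h%:R]) -> p = q.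
Proof.
move=> pq; apply/eqP; rewrite -subr_eq0; apply/negPn/negP => nz.
pose rs := [seq (i%:R : rat) | i <- iota 0 (size (p - q))].
have := @max_poly_roots _ _ rs nz.
rewrite size_map size_iota ltnn => H; suff : false by []; apply: H.
  by apply/allP => x /mapP[i _ ->]; rewrite /root hornerD hornerN pq subrr.
rewrite map_inj_uniq ?iota_uniq // => i j /eqP.
by rewrite eqr_nat => /eqP.
Qed.

(** Linear factors split off one root at a time in any integral domain; over the
integers, the quotient stays integral. *)
Lemma factor_roots (R : idomainType) (p : {poly R}) (rs : seq R) :
  uniq rs -> all (root p) rs -> exists q, p = q * \prod_(z <- rs) ('X - z%:P).
Proof.
elim: rs p => [|z rs IHrs] p /=; first by exists p; rewrite big_nil mulr1.
case/andP=> z_rs urs /andP[/factor_theorem[p' ->] rootp].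
have [|q ->] := IHrs p' urs; last by exists q; rewrite big_cons mulrAC mulrA.
apply/allP => y ys; have := allP rootp y ys; rewrite rootM => /orP[// |].
by rewrite root_XsubC => /eqP eq_y; rewrite -eq_y ys in z_rs.
Qed.

(** The integers that clear the denominators of f form an ideal, so the remainder of
N modulo the least positive one clears them too and must vanish. *)
Lemma den_dvd (f : {poly rat}) (N : nat) : clears_den f N -> (den f %| N)%N.
Proof.
rewrite /den => NP; case: ex_minnP => D /andP[D_gt0 /polyOverP Dint] Dmin.
have [/polyOverP Nint N_gt0] : N%:R *: f \is a polyOver Num.int /\ (0 < N)%N.
  by case/andP: NP.
rewrite /dvdn; have [// | r_gt0] := posnP (N %% D).
suff /Dmin : clears_den f (N %% D) by rewrite leqNgt ltn_mod D_gt0.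
apply/andP; split=> //; apply/polyOverP => i; rewrite coefZ.
have -> : (N %% D)%:R = N%:R - (N %/ D)%:R * D%:R :> rat.
  by rewrite [X in _ = X%:R - _](divn_eq N D) natrD natrM; ring.
rewrite mulrBl -mulrA; have := Nint i; have := Dint i; rewrite !coefZ => Di Ni.
by rewrite rpredB // rpredM // rpred_nat.
Qed.

(** The coefficient of X^i in (X - m/2)^j contains m/2 to the power j - i. *)
Lemma half_power_coef_int (m i j k : nat) : (j <= i + k)%N ->
  2%:R ^+ k * (('X - (m%:R / 2%:R)%:P) ^+ j)`_i \is a @Num.int rat.
Proof.
elim: j i k => [|j IHj] i k le_j.
  by rewrite expr0 coef1 rpredM ?rpredX ?rpred_nat.
rewrite exprS mulrBl coefB coefXM coefCM mulrBr rpredB //.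
  by case: i le_j => [|i] le_j; rewrite ?mulr0 ?rpred0 //= IHj //; lia.
case: k le_j => [|k] le_j.
  rewrite nth_default ?mulr0 ?rpred0 // size_exp_XsubC; lia.
have -> : 2%:R ^+ k.+1 * (m%:R / 2%:R * (('X - (m%:R / 2%:R)%:P) ^+ j)`_i)
   = m%:R * (2%:R ^+ k * (('X - (m%:R / 2%:R)%:P) ^+ j)`_i) :> rat.
  by rewrite exprS; field.
by rewrite rpredM ?rpred_nat // IHj //; lia.
Qed.

(** Positive degree is what saves a power of 2: in degree l + 1 at most, a
coefficient of X^(i+1) only involves (m/2)^s with s <= l. *)
Lemma half_shift_coef_int (m l i : nat) (v : {poly int}) : (size v <= l.+2)%N ->
  2%:R ^+ l * (map_poly intr v \Po ('X - (m%:R / 2%:R)%:P))`_i.+1 \is a @Num.int rat.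
Proof.
have szQ : size (map_poly intr v : {poly rat}) = size v.
  by rewrite size_map_inj_poly //; apply: intr_inj.
move=> szv; rewrite coef_comp_poly mulr_sumr; apply: rpred_sum => j _.
rewrite mulrCA coef_map rpredM //; first exact: intr_int.
apply: half_power_coef_int.
by have := ltn_ord j; rewrite [X in (j < X)%N]szQ; lia.
Qed.

Lemma odd_dexp (a : nat) : odd (dexp a) = odd a.
Proof.
have -> : dexp a = uphalf (a * a) by [].
set b := a./2; have -> : (a * a = 4 * (b * b + odd a * b) + odd a)%N.
  by rewrite -[a in LHS]odd_double_half -/b; case: (odd a); lia.
by case: (odd a); lia.
Qed.

Theorem theorem1p4 (a : nat) (ha : (2 <= a)%N) :
  exists Qa : {poly rat},
    [/\ unique (extends_Qcount a) Qa,
        size Qa = (dexp a).+1 &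
        exists q : {poly rat},
          [/\ unique (fun f : {poly rat} =>
                [/\ f != 0, even_polynomial f & Q_factorization a Qa f]) q,
              size q = (ell a).+1 &
              (den q %| (if odd a then 2 ^ ell a else 1)
                          * ((dexp a)`! %/ (a - 1)`!))%N]].
Proof.
case: a ha => // n n_gt0; have {n_gt0} n_gt0 : (0 < n)%N by [].
have [Q [QE szQ Qrecip Qroot [G GE]]] := Qcount_polynomial n_gt0.
have odd_d := odd_dexp n.+1; have ellE : ell n.+1 = (dexp n.+1 - n.+1)%N by [].
move: (dexp n.+1) => d in szQ Qrecip GE odd_d ellE *.
have Q_neq0 : Q != 0 by rewrite -size_poly_eq0 szQ.
have df_neq0 : d`!%:R != 0 :> rat by rewrite pnatr_eq0 -lt0n fact_gt0.
exists Q; split=> //.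
  by split=> // Q' Q'E; apply: poly_eq_on_nat => h; rewrite QE Q'E.
pose c : rat := n.+1%:R / 2%:R.
have [V VE] : exists V : {poly int}, d`!%:R *: Q
    = map_poly intr V * \prod_(i < n) ('X + i.+1%:R).
  pose rs : seq int := [seq - i.+1%:Z | i <- index_iota 0 n].
  have urs : uniq rs by rewrite map_inj_uniq ?iota_uniq // => i j; lia.
  have rootG : all (root G) rs.
    apply/allP => z /mapP[i]; rewrite mem_index_iota => /andP[_ lt_in] ->.
    rewrite /root -(eqr_int rat) -horner_map /= -GE hornerZ rmorphN /=.
    by rewrite -pmulrn Qroot // mulr0.
  have [V GV] := factor_roots urs rootG; exists V.
  rewrite GE GV rmorphM rmorph_prod /=; congr (_ * _).
  rewrite big_map big_mkord; apply: eq_bigr => i _.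
  rewrite rmorphB /= map_polyX map_polyC /=.
  by rewrite mulrNz polyCN opprK -polyC_natr.
pose E : {poly rat} := \prod_(i < n) ('X + c%:P - 1 - i%:R).
pose W := map_poly intr V \Po ('X - c%:P).
have cE : n.+1%:R = c%:P + c%:P :> {poly rat}.
  by rewrite -polyC_natr -polyCD; congr (_%:P); rewrite /c; field.
(* The roots of E are symmetric about 0, as reversing the order of the factors shows. *)
have EE : E = \prod_(i < n) ('X - c%:P + i.+1%:R).
  rewrite /E (reindex_inj rev_ord_inj); apply: eq_bigr => i _ /=.
  have -> : (n - i.+1 = n.+1 - i.+2)%N by [].
  by rewrite natrB ?ltnS // cE -[i.+2%:R]natr1; ring.
have WE : d`!%:R *: (Q \Po ('X - c%:P)) = W * E.
  rewrite -comp_polyZ VE comp_polyM EE; congr (_ * _).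
  rewrite rmorph_prod /=; apply: eq_bigr => i _.
  by rewrite comp_polyD comp_polyX -polyC_natr comp_polyC.
have E_monic : E \is monic.
  rewrite EE; apply: monic_prod => i _.
  by rewrite -polyC_natr -addrA -polyCN -polyCD monicXaddC.
have E_neq0 : E != 0 by apply: monic_neq0.
have EN : E \Po (- 'X) = (-1) ^+ n * E.
  rewrite {1}/E EE rmorph_prod /= -[n in (-1) ^+ n]card_ord -prodrN; apply: eq_bigr => i _.
  by rewrite !comp_polyB comp_polyD comp_polyX comp_polyC -polyC_natr -polyC1 !comp_polyC -natr1; ring.
have QN : Q \Po (- 'X - n.+1%:R) = (-1) ^+ d *: Q.
  apply: poly_eq_on_nat => h; rewrite horner_comp hornerZ -Qrecip; congr (Q.[_]).
  by rewrite -polyC_natr !hornerE natrD; ring.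
have RN : (Q \Po ('X - c%:P)) \Po (- 'X) = (-1) ^+ n.+1 *: (Q \Po ('X - c%:P)).
  have -> : (-1) ^+ n.+1 = (-1) ^+ d :> rat by rewrite -signr_odd -[RHS]signr_odd odd_d.
  rewrite -comp_polyZ -QN -!comp_polyA; congr (Q \Po _).
  rewrite !comp_polyB comp_polyC !raddfN /= !comp_polyX -polyC_natr comp_polyC polyC_natr cE.
  by ring.
(* Q(X - c) has the parity of n + 1, and E that of n. *)
have WN : W \Po (- 'X) = - W.
  apply: (mulIf E_neq0); apply: (@mulfI _ ((-1) ^+ n)); first by rewrite signr_eq0.
  rewrite mulrCA -EN -comp_polyM -WE comp_polyZ RN scalerA mulrC -scalerA WE.
  by rewrite exprS -scalerA scaleN1r -mul_polyC rmorphXn rmorphN1 mulNr mulrN.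
have W0 : root W 0.
  have := congr1 (fun p => p.[0]) WN; rewrite /root horner_comp !hornerN hornerX oppr0.
  by move=> W0; apply/eqP; lra.
have [Z ZE] := factor_theorem _ _ W0; rewrite subr0 in ZE.
have X_neq0 : 'X != 0 :> {poly rat} by rewrite polyX_eq0.
have ZN : Z \Po (- 'X) = Z.
  apply: (mulIf X_neq0); apply: oppr_inj; rewrite -ZE -WN ZE comp_polyM comp_polyX.
  by rewrite mulrN.
have W_neq0 : W != 0.
  apply: contra_neq Q_neq0 => W0'; have /eqP := WE; rewrite W0' mul0r scaler_eq0 (negbTE df_neq0) /=.
  by rewrite comp_poly_eq0 ?size_XsubC // => /eqP.
have Z_neq0 : Z != 0 by apply: contra_neq W_neq0; rewrite ZE => ->; rewrite mul0r.
have szE : size E = n.+1.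
  by rewrite EE (eq_bigr (fun i : 'I_n => 'X - (c - i.+1%:R)%:P)) => [|i _];
    [rewrite size_prod_XsubC /index_enum -enumT size_enum_ord | rewrite polyCB -polyC_natr; ring].
have szZ : size Z = (ell n.+1).+1.
  have : size (W * E) = d.+1 by rewrite -WE size_scale // size_comp_poly2 ?size_XsubC.
  rewrite size_mul // szE ZE size_mulX // ellE; have : (0 < size Z)%N by rewrite size_poly_gt0.
  by move: (size Z) => s; clear; lia.
pose q := (n`!%:R / d`!%:R) *: Z.
have nf_neq0 : n`!%:R != 0 :> rat by rewrite pnatr_eq0 -lt0n fact_gt0.
have qE : Q_factorization n.+1 Q q.
  rewrite /Q_factorization /binom_poly subn1 /= -/c -/E /q; apply: (scalerI df_neq0).
  have unit_consts : d`!%:R%:P * (n`!%:R^-1)%:P * (n`!%:R / d`!%:R)%:P = 1 :> {poly rat}.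
    by rewrite -!polyCM -[RHS]polyC1; congr (_%:P); field; rewrite ?nf_neq0 ?df_neq0.
  by rewrite WE ZE -!mul_polyC -[LHS]mul1r -unit_consts; ring.
have q_neq0 : q != 0 by rewrite scaler_eq0 negb_or Z_neq0 mulf_neq0 ?invr_eq0.
exists q; split.
- split.
    by split=> //; rewrite /even_polynomial /q comp_polyZ ZN.
  move=> f [_ _ fE]; rewrite /Q_factorization qE in fE.
  apply: mulfI fE; rewrite mulf_neq0 // scaler_eq0 invr_eq0 negb_or subn1 /=.
  by rewrite nf_neq0.
- by rewrite /q size_scale // mulf_neq0 ?invr_eq0.
- have le_nd : (n <= d)%N.
    have : size (W * E) = d.+1 by rewrite -WE size_scale // size_comp_poly2 ?size_XsubC.
    by rewrite size_mul // szE ZE size_mulX // -?size_poly_gt0; lia.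
  apply: den_dvd; rewrite subn1 /=; apply/andP; split.
    rewrite muln_gt0 divn_gt0 ?fact_gt0 // leq_fact // andbT; by case: ifP; rewrite ?expn_gt0.
  rewrite /q scalerA.
  have -> : ((if ~~ odd n then 2 ^ ell n.+1 else 1) * (d`! %/ n`!))%N%:R * (n`!%:R / d`!%:R)
     = if ~~ odd n then 2%:R ^+ ell n.+1 else 1 :> rat.
    have fact_dvd : (n`! %| d`!)%N by rewrite (fact_split le_nd) dvdn_mulr.
    have quot1 : (d`! %/ n`!)%:R * (n`!%:R / d`!%:R) = 1 :> rat.
      by rewrite mulrA -natrM divnK // divff.
    rewrite natrM -mulrA quot1 mulr1.
    by case: (odd n); rewrite // natrX.
  apply/polyOverP => i; rewrite coefZ.
  have -> : Z`_i = W`_i.+1 by rewrite ZE coefMX.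
  (* For n odd, c is an integer and the shift creates no denominators. *)
  have [odd_n | even_n] := boolP (odd n).
    rewrite mul1r /W.
    have -> : 'X - c%:P = map_poly intr ('X - (n.+1./2)%:R) :> {poly rat}.
      rewrite rmorphB /= map_polyX rmorph_nat -polyC_natr; congr (_ - _%:P).
      rewrite /c -[X in X%:R / _]odd_double_half /= odd_n add0n -muln2 natrM.
      by rewrite mulfK // pnatr_eq0.
    by rewrite -map_comp_poly coef_map /= intr_int.
  apply: half_shift_coef_int.
  have : size (W * E) = d.+1 by rewrite -WE size_scale // size_comp_poly2 ?size_XsubC.
  rewrite size_mul // szE ellE size_comp_poly2 ?size_XsubC // size_map_inj_poly //.
    by move: (size V) le_nd => s; clear; lia.
  exact: intr_inj.
Qed.
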